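(* If $G$ and $H$ are limit aperiodic groups and $$1\to G\xrightarrow{\ \tau\ }E\xrightarrow{\ \pi\ }H\to 1$$ is a short exact sequence of groups, then $E$ is also a limit aperiodic group.
   Context: For a group $G$ (not necessarily finitely generated) and a finite set $F$ with the discrete topology, $F^G$ denotes the set of all maps $G\to F$ with the product topology, and $G$ acts on $F^G$ by $(g\ast f)(a)=f(g^{-1}a)$. A map $\phi\in F^G$ is aperiodic if $b\ast\phi=\phi$ (with $b\in G$) implies $b=e$. A map $f\in F^G$ is limit aperiodic if every $\phi$ in the closure $\overline{\mathrm{Orb}_G(f)}$ of its $G$-orbit in $F^G$ is aperiodic. A group $G$ is limit aperiodic if there exist a finite set $F$ and a limit aperiodic map $f:G\to F$. *)

(* Defs.v *)
From HB Require Import structures.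
From mathcomp Require Import all_boot.
From mathcomp Require Import boolp classical_sets topology.

Set Implicit Arguments.
Unset Strict Implicit.
Unset Printing Implicit Defensive.

Local Open Scope classical_set_scope.
Local Open Scope group_scope.

(* [{ptws _ -> _}] is the product topology; [discrete_topology F] makes the
   factor discrete whatever topology F may carry elsewhere. *)
Definition colorings (G : groupType) (F : finType) :=
  {ptws G -> discrete_topology F}.

Definition shift (G : groupType) (F : finType) (g : G)
    (f : colorings G F) : colorings G F :=
  fun a => f (g^-1 * a).

Definition orb (G : groupType) (F : finType) (f : colorings G F) :
    set (colorings G F) :=
  range (fun g => shift g f).

Definition aperiodic (G : groupType) (F : finType) (phi : colorings G F) : Prop :=
  forall b : G, shift b phi = phi -> b = 1.

Definition limit_aperiodic_map (G : groupType) (F : finType)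
    (f : colorings G F) : Prop :=
  forall phi : colorings G F, closure (orb f) phi -> aperiodic phi.

Definition limit_aperiodic (G : groupType) : Prop :=
  exists (F : finType) (f : colorings G F), limit_aperiodic_map f.

Definition mor_kernel (A B : groupType) (f : UMagmaMorphism.type A B) : set A :=
  f @^-1` [set 1].

Definition short_exact (G E H : groupType)
    (tau : UMagmaMorphism.type G E) (pi : UMagmaMorphism.type E H) : Prop :=
  [/\ mor_kernel tau = [set 1], range tau = mor_kernel pi & range pi = setT].

(* Main.v *)
Require Import Defs.
From mathcomp Require Import all_boot.
From mathcomp Require Import boolp classical_sets filter topology.

(** Choose a set-theoretic section [s] of [pi], so that every [x] in [E] is
    [s (pi x) * tau (k x)] for a unique [k x] in [G], and colour [x] by the pair
    [(fG (k x), fH (pi x))]. A limit of translates has a second coordinate that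
    factors through [pi] as a limit of translates of [fH], so its periods lie in
    the kernel of [pi]; its first coordinate restricts along [tau] to a limit of
    translates of [fG], so it has no nontrivial period in [tau G]. Writing the
    section on the left of [tau (k x)] is essential: it makes [k] equivariant for
    right translation by [tau G], whereas the other order would twist the
    translates of [fG] by the infinitely many automorphisms of [G] induced by
    conjugation. *)

Set Implicit Arguments.
Unset Strict Implicit.
Unset Printing Implicit Defensive.

Local Open Scope classical_set_scope.
Local Open Scope group_scope.

Lemma continuous_ptws (S T : topologicalType) (I : eqType)
    (h : S -> {ptws I -> T}) :
  (forall i, continuous (fun x => h x i)) -> continuous h.
Proof.
move=> hc x; apply/cvg_sup => i B.
move=> -[_ [[C oC <-] Cx] CB].
apply: (@filterS _ (h @ x)) CB _.
by apply: (hc i x); exact: open_nbhs_nbhs.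
Qed.

Lemma closure_image_continuous (S T : topologicalType) (h : S -> T) (A : set S)
    (x : S) :
  continuous h -> closure A x -> closure (h @` A) (h x).
Proof.
move=> hc Ax B /hc /Ax [y [Ay By]].
by exists (h y); split => //; exists y.
Qed.

Lemma eval_continuous (I : eqType) (T : topologicalType) (i : I) :
  continuous (fun phi : {ptws I -> T} => phi i).
Proof. exact: (@proj_continuous I (fun=> T) i). Qed.

Section Recoloring.
Variables (A B : groupType) (F F' : finType).

Definition recolor (h : F -> F') (r : A -> B) (phi : colorings B F) :
  colorings A F' := fun a => h (phi (r a)).

Lemma recolor_continuous (h : F -> F') (r : A -> B) : continuous (recolor h r).
Proof.
apply: continuous_ptws => a phi.
apply: (@continuous_comp _ (discrete_topology F) (discrete_topology F')
  (fun psi : colorings B F => psi (r a)) h).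
  exact: eval_continuous.
by move=> C /nbhs_singleton Ch; apply: filterS (discrete_set1 _) => _ ->.
Qed.

(** Continuity of [recolor h r] carries limits along once translates of [f] go to translates of
    [f']. This lets [r] be a section that is only a map of sets. *)
Lemma closure_orb_recolor (h : F -> F') (r : A -> B) (f : colorings B F)
    (f' : colorings A F') (phi : colorings B F) :
  (forall y, exists z, recolor h r (shift y f) = shift z f') ->
  closure (orb f) phi -> closure (orb f') (recolor h r phi).
Proof.
move=> hf /(closure_image_continuous (@recolor_continuous h r)).
apply: closureS => _ [_ [y _ <-] <-].
by have [z ->] := hf y; exists z.
Qed.

End Recoloring.

(** Prescribing the values at [x] and [y] gives a neighbourhood of [phi], which must meet [A]. *)
Lemma closure_rel2 (G : groupType) (F : finType) (A : set (colorings G F))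
    (R : F -> F -> Prop) (x y : G) (phi : colorings G F) :
  (forall psi, A psi -> R (psi x) (psi y)) ->
  closure A phi -> R (phi x) (phi y).
Proof.
move=> AR /(_ [set psi | psi x = phi x /\ psi y = phi y]) [].
  have near_eq z : nbhs phi [set psi | psi z = phi z].
    exact: (@eval_continuous _ (discrete_topology F) z phi _
      (@discrete_set1 (discrete_topology F) _)).
  exact: (@filterI _ _ (nbhs_filter (phi : {ptws G -> discrete_topology F})) _ _
    (near_eq x) (near_eq y)).
by move=> psi [/AR + [<- <-]].
Qed.

Theorem corollary3p6 (G E H : groupType)
    (tau : UMagmaMorphism.type G E) (pi : UMagmaMorphism.type E H)
    (hG : limit_aperiodic G) (hH : limit_aperiodic H)
    (hex : short_exact tau pi) :
  limit_aperiodic E.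
Proof.
have [FG [fG hfG]] := hG; have [FH [fH hfH]] := hH.
have [kertau imtau impi] := hex.
have tau_inj : injective tau.
  apply: gmulf_inj => x tx.
  have : mor_kernel tau x := tx.
  by rewrite kertau.
have pitau g : pi (tau g) = 1.
  have : range tau (tau g) by exists g.
  by rewrite imtau.
have pi_surj h : exists e, pi e = h.
  have : range pi h by rewrite impi.
  by move=> [e _ eh]; exists e.
have [s sK] := choice pi_surj.
have tau_onto x : exists g, tau g = (s (pi x))^-1 * x.
  have : range tau ((s (pi x))^-1 * x).
    by rewrite imtau /mor_kernel /= gmulfM gmulfV sK mulVg.
  by move=> [g _ gx]; exists g.
have [k kE] := choice tau_onto.
have kM x g : k (x * tau g) = k x * g.
  by apply: tau_inj; rewrite gmulfM !kE gmulfM pitau mulg1 mulgA.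
exists (FG * FH)%type, (fun x => (fG (k x), fH (pi x))) => phi cphi b bphi.
have cphiH : closure (orb fH) (recolor snd s phi).
  apply: closure_orb_recolor cphi => y; exists (pi y).
  by apply/funext => h; rewrite /recolor /shift /= gmulfM gmulfV sK.
have cphiG : closure (orb fG) (recolor fst tau phi).
  (* At [tau g] the translate by [y] reads [fG] at [k (y^-1 * tau g) = k y^-1 * g]. *)
  apply: closure_orb_recolor cphi => y; exists (k y^-1)^-1.
  by apply/funext => g; rewrite /recolor /shift /= kM invgK.
have phi_fiber x y : pi x = pi y -> (phi x).2 = (phi y).2.
  move=> xy; apply: (closure_rel2 (R := fun c d => c.2 = d.2)) cphi.
  by move=> _ [z _ <-]; rewrite /shift /= !gmulfM xy.
have pib : pi b = 1.
  apply: hfH cphiH _ _; apply/funext => h; rewrite /recolor /shift.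
  (* The points [s ((pi b)^-1 * h)] and [b^-1 * s h] lie in one fibre of [pi]. *)
  by rewrite -[in RHS]bphi; apply: phi_fiber; rewrite gmulfM gmulfV !sK.
have : range tau b by rewrite imtau.
move=> [g _ gb]; rewrite -gb.
suff -> : g = 1 by rewrite gmulf1.
(* The period [b = tau g] of [phi] becomes the period [g] of its restriction along [tau]. *)
apply: hfG cphiG _ _; apply/funext => a; rewrite /recolor /shift.
by rewrite -[in RHS]bphi /shift -gb gmulfM gmulfV.
Qed.
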